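(* Let $n\ge 1$. Let $\mathcal{R}_n\subseteq\mathcal{M}_n$ be the family of $n\times n$ complex upper triangular matrices and let $\widehat{\mathcal{R}}_n\subseteq\mathcal{M}_n$ be the family of $n\times n$ upper triangular matrices with constant diagonal. Then $\mathcal{R}_n$ and $\widehat{\mathcal{R}}_n$ form a multiplicative finite free complementary pair, i.e. $\mathcal{R}_n^{\boxtimes}=\widehat{\mathcal{R}}_n$ and $\widehat{\mathcal{R}}_n^{\,\boxtimes}=\mathcal{R}_n$.
   Context: $\mathcal{M}_n=\mathbb{C}^{n\times n}$ and $\chi_A(x)=\det(xI-A)$. For polynomials $p(x)=\sum_{k=0}^n a_kx^{n-k}$ and $q(x)=\sum_{k=0}^n b_kx^{n-k}$ of degree $n$ over $\mathbb{C}$, the multiplicative convolution is $p(x)\boxtimes q(x)=\sum_{k=0}^n\frac{(-1)^k}{\binom{n}{k}}a_kb_kx^{n-k}$. For $\mathcal{A}\subseteq\mathcal{M}_n$, $\mathcal{A}^{\boxtimes}$ is the set of all $B\in\mathcal{M}_n$ such that $\chi_{AB}(x)=\chi_A(x)\boxtimes\chi_B(x)$ for every $A\in\mathcal{A}$. Sets $\mathcal{E},\mathcal{F}\subseteq\mathcal{M}_n$ form a multiplicative finite free complementary pair if $\mathcal{E}^{\boxtimes}=\mathcal{F}$ and $\mathcal{F}^{\boxtimes}=\mathcal{E}$. *)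

(* Defs.v *)
From HB Require Import structures.
From mathcomp Require Import all_boot all_order all_algebra.
From mathcomp Require Import classical_sets reals.
From mathcomp Require Import complex.

Set Implicit Arguments.
Unset Strict Implicit.
Unset Printing Implicit Defensive.

Import GRing.Theory.

Local Open Scope ring_scope.
Local Open Scope classical_set_scope.
Local Open Scope complex_scope.

(* The coefficients are numbered from the top: the paper's a_k is p`_(n - k).
   Intended for p and q of degree n (size n.+1). *)
Definition mult_conv (R : realType) (n : nat) (p q : {poly R[i]}) :
    {poly R[i]} :=
  \sum_(k < n.+1)
    ((-1) ^+ k / 'C(n, k)%:R * p`_(n - k) * q`_(n - k)) *: 'X^(n - k).

Definition mult_compl (R : realType) (n : nat) (A : set 'M[R[i]]_n) :
    set 'M[R[i]]_n :=
  [set b : 'M[R[i]]_n | forall a, A a ->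
     char_poly (a *m b) = mult_conv n (char_poly a) (char_poly b)].

Definition mult_complementary_pair (R : realType) (n : nat)
    (E F : set 'M[R[i]]_n) : Prop :=
  mult_compl E = F /\ mult_compl F = E.

(* [is_trig_mx] means lower triangular, hence the transpose. *)
Definition upper_trig (R : realType) (n : nat) : set 'M[R[i]]_n :=
  [set a : 'M[R[i]]_n | is_trig_mx a^T].

Definition upper_trig_cst_diag (R : realType) (n : nat) : set 'M[R[i]]_n :=
  [set a : 'M[R[i]]_n | is_trig_mx a^T /\ exists c : R[i], forall i, a i i = c].

(* Main.v *)
Require Import Defs.
From HB Require Import structures.
From mathcomp Require Import all_boot all_order all_algebra.
From mathcomp Require Import classical_sets reals.
From mathcomp Require Import complex ring.

(** Two facts about the convolution identity
    $\chi_{AB} = \chi_A \boxtimes \chi_B$ give the theorem.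

    Sufficiency. If $A$ and $B$ are upper triangular, $AB$ is upper triangular
    with diagonal entries $a_{ii} b_{ii}$. If moreover every $b_{ii}$ is $c$,
    then $\chi_B = (x - c)^n$, whose coefficients $\binom{n}{k} (-c)^k$ cancel
    the weights of the convolution: the right-hand side is obtained from
    $\chi_A$ by multiplying its $k$-th coefficient by $c^k$. Multiplying all
    the roots of a monic polynomial by $c$ has the same effect on its
    coefficients ([coef_prod_XsubC_scale]), so the identity holds
    ([char_poly_mul_cst_diag]). It is symmetric for triangular matrices, and so
    gives one inclusion in each of the two set equalities.

    Necessity. The coefficient of $x^{n-1}$ in the identity says
    $n\,\mathrm{tr}(AB) = \mathrm{tr} A\,\mathrm{tr} B$ ([mult_compl_trace]).
    This trace condition alone, tested on matrix units, is enough for the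
    converse inclusions: for $i < j$ the unit $E_{ij}$ belongs to both families
    and has trace $0$, which forces $b_{ji} = 0$
    ([mult_compl_delta_upper_trig]); the unit $E_{ii}$ is upper triangular with
    trace $1$, which forces $n b_{ii} = \mathrm{tr} B$ for every $i$. *)

Set Implicit Arguments.
Unset Strict Implicit.
Unset Printing Implicit Defensive.

Import GRing.Theory Num.Theory.

Local Open Scope ring_scope.
Local Open Scope classical_set_scope.
Local Open Scope complex_scope.

(** The coefficient of degree $k$ is, up to sign, the elementary symmetric
    function of degree $m - k$ in the $m$ roots, hence homogeneous of that
    degree. Induction on the roots covers $c = 0$ as well, for which the
    substitution of $x / c$ for $x$ is meaningless. *)
Lemma coef_prod_XsubC_scale (K : comNzRingType) (I : Type) (r : seq I)
    (F : I -> K) (c : K) (k : nat) : (k <= size r)%N ->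
  (\prod_(i <- r) ('X - (c * F i)%:P))`_k =
    c ^+ (size r - k) * (\prod_(i <- r) ('X - (F i)%:P))`_k.
Proof.
elim: r k => [|i r IHr] k /=.
  by rewrite leqn0 => /eqP->; rewrite !big_nil mul1r.
rewrite !big_cons !mulrBl !coefB !coefXM !coefCM mulrBr leq_eqVlt.
case/orP=> [/eqP-> /= | lt_k].
  (* k is here one more than the degree of the products over the tail *)
  rewrite [X in _ - _ * X]nth_default ?size_prod_XsubC //.
  rewrite [X in _ = _ - _ * (_ * X)]nth_default ?size_prod_XsubC //.
  by rewrite IHr // subSS !mulr0.
have le_k : (k <= size r)%N by rewrite -ltnS.
rewrite (IHr k) // (subSn le_k) exprS; congr (_ - _); last first.
  by rewrite -!mulrA; congr (_ * _); rewrite mulrCA.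
case: k {lt_k} le_k => [|k] lt_k; rewrite ?mulr0 //= IHr 1?ltnW //.
by rewrite -exprS subnSK.
Qed.

Lemma coef_XsubC_exp (K : comNzRingType) (c : K) (n k : nat) : (k <= n)%N ->
  (('X - c%:P) ^+ n)`_k = (-1) ^+ (n - k) * c ^+ (n - k) * 'C(n, k)%:R.
Proof.
move=> le_kn; rewrite -polyCN addrC exprDn coef_sum.
have coef_term (i : 'I_n.+1) :
    ((- c)%:P ^+ (n - i) * 'X^i *+ 'C(n, i))`_k =
      (- c) ^+ (n - i) * (k == i)%:R * 'C(n, i)%:R.
  by rewrite coefMn -polyC_exp coefCM coefXn [RHS]mulr_natr.
have lt_k : (k < n.+1)%N by [].
rewrite (bigD1 (Ordinal lt_k)) //= (coef_term (Ordinal lt_k)) eqxx mulr1.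
rewrite -exprNn big1 ?addr0 // => i /negPf ne_ik; rewrite coef_term.
by rewrite -val_eqE /= eq_sym in ne_ik; rewrite ne_ik mulr0 mul0r.
Qed.

Lemma upper_trigP (R : realType) (n : nat) (a : 'M[R[i]]_n) :
  upper_trig a <-> forall i j : 'I_n, (j < i)%N -> a i j = 0.
Proof.
split=> [/is_trig_mxP a_trig i j lt_ji | a_trig].
  by have := a_trig _ _ lt_ji; rewrite mxE.
by apply/is_trig_mxP => i j lt_ij; rewrite mxE a_trig.
Qed.

Lemma upper_trig_mulmxE (R : realType) (n : nat) (a b : 'M[R[i]]_n) (i j : 'I_n) :
  upper_trig a -> upper_trig b -> (j <= i)%N ->
  (a *m b) i j = a i i * b i j.
Proof.
move=> /upper_trigP a_trig /upper_trigP b_trig le_ji.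
rewrite mxE (bigD1 i) //= big1 ?addr0 // => k ne_ki.
have [lt_ki | lt_ik | eq_ki] := ltngtP k i.
- by rewrite a_trig ?mul0r.
- by rewrite b_trig ?mulr0 // (leq_ltn_trans le_ji).
- by case/eqP: ne_ki; apply: val_inj.
Qed.

Lemma char_poly_upper_trig (R : realType) (n : nat) (a : 'M[R[i]]_n) :
  upper_trig a -> char_poly a = \prod_(i < n) ('X - (a i i)%:P).
Proof.
move=> a_trig.
have -> : char_poly a = char_poly a^T.
  by rewrite /char_poly -det_tr; congr (\det _); apply/matrixP=> i j;
    rewrite !mxE eq_sym.
by rewrite char_poly_trig //; apply: eq_bigr => i _; rewrite mxE.
Qed.

Lemma char_poly_upper_trigM (R : realType) (n : nat) (a b : 'M[R[i]]_n) :
  upper_trig a -> upper_trig b ->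
  char_poly (a *m b) = \prod_(i < n) ('X - (a i i * b i i)%:P).
Proof.
move=> a_trig b_trig; rewrite char_poly_upper_trig.
  by apply: eq_bigr => i _; rewrite upper_trig_mulmxE.
apply/upper_trigP => i j lt_ji; rewrite upper_trig_mulmxE // 1?ltnW //.
by rewrite (proj1 (upper_trigP b) b_trig) ?mulr0.
Qed.

Lemma coef_mult_conv (R : realType) (n : nat) (p q : {poly R[i]}) (k : nat) :
  (mult_conv n p q)`_k =
    if (k <= n)%N then (-1) ^+ (n - k) / 'C(n, k)%:R * p`_k * q`_k else 0.
Proof.
rewrite coef_sum; case: leqP => [le_kn | lt_nk]; last first.
  rewrite big1 // => i _; rewrite coefZ coefXn gtn_eqF ?mulr0 //.
  by rewrite (leq_ltn_trans (leq_subr _ _)).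
rewrite (bigD1 (inord (n - k))) //= big1 => [|i /eqP ne_i].
  rewrite addr0 inordK ?ltnS ?leq_subr // subKn // coefZ coefXn eqxx mulr1.
  by rewrite bin_sub.
rewrite coefZ coefXn; case: eqP => [eq_k | _]; last by rewrite mulr0.
case: ne_i; apply: val_inj.
by rewrite /= eq_k inordK subKn // -ltnS.
Qed.

Lemma mult_convC (R : realType) (n : nat) (p q : {poly R[i]}) :
  mult_conv n p q = mult_conv n q p.
Proof. by apply: eq_bigr => k _; rewrite mulrAC. Qed.

(** The coefficients of $(x - c)^n$ cancel the signs and the binomials of the
    convolution, which leaves the effect of multiplying every root of
    $\chi_A$ by $c$. *)
Lemma char_poly_mul_cst_diag (R : realType) (n : nat) (a b : 'M[R[i]]_n) :
  upper_trig a -> upper_trig_cst_diag b ->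
  char_poly (a *m b) = mult_conv n (char_poly a) (char_poly b).
Proof.
move=> a_trig [b_trig [c b_diag]]; apply/polyP => k; rewrite coef_mult_conv.
case: leqP => [le_kn | lt_nk]; last by rewrite nth_default ?size_char_poly.
rewrite char_poly_upper_trigM // !char_poly_upper_trig //.
under eq_bigr => i _ do rewrite b_diag mulrC.
under [\prod_(i < n) ('X - (b i i)%:P)]eq_bigr => i _ do rewrite b_diag.
have size_n : size (index_enum 'I_n) = n.
  by rewrite -[RHS]card_ord cardT enumT.
rewrite coef_prod_XsubC_scale size_n // prodr_const card_ord coef_XsubC_exp //.
have bin_neq0 : 'C(n, k)%:R != 0 :> R[i] by rewrite pnatr_eq0 -lt0n bin_gt0.
set s := (-1) ^+ _; set p_k := _`_k; set c_k := c ^+ _.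
have ss1 : s * s = 1 by rewrite /s -expr2 sqrr_sign.
rewrite [RHS](_ : _ = (s * s) * ('C(n, k)%:R^-1 * 'C(n, k)%:R) * (c_k * p_k)).
  by rewrite ss1 mulVf // !mul1r.
by ring.
Qed.

(** For triangular matrices both sides of the convolution identity are
    symmetric, since the diagonal of a product is the product of the
    diagonals. *)
Lemma char_poly_cst_diag_mul (R : realType) (n : nat) (a b : 'M[R[i]]_n) :
  upper_trig_cst_diag a -> upper_trig b ->
  char_poly (a *m b) = mult_conv n (char_poly a) (char_poly b).
Proof.
move=> a_cst b_trig; have [a_trig _] := a_cst.
rewrite mult_convC -char_poly_mul_cst_diag // !char_poly_upper_trigM //.
by apply: eq_bigr => i _; rewrite mulrC.
Qed.

(** This is the coefficient of degree $n - 1$ of the convolution identity. *)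
Lemma mult_compl_trace (R : realType) (n : nat) (E : set 'M[R[i]]_n)
    (a b : 'M[R[i]]_n) :
  (0 < n)%N -> mult_compl E b -> E a -> n%:R * \tr (a *m b) = \tr a * \tr b.
Proof.
move=> n_gt0 bE aE; have /(congr1 (fun p : {poly _} => p`_n.-1)) := bE a aE.
rewrite coef_mult_conv leq_pred !char_poly_trace // -subn1 subKn //.
rewrite bin_sub // bin1 expr1 -mulrA mulrNN mulNr mulNr => /oppr_inj ->.
by rewrite mul1r mulVKf // pnatr_eq0 -lt0n.
Qed.

Lemma mxtrace_delta (K : pzSemiRingType) (n : nat) (i j : 'I_n) :
  \tr (delta_mx i j : 'M[K]_n) = (i == j)%:R.
Proof.
rewrite /mxtrace (bigD1 i) //= big1 => [|k /negPf ne_ki]; rewrite !mxE.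
  by rewrite eqxx addr0.
by rewrite ne_ki.
Qed.

Lemma mxtrace_delta_mul (K : pzSemiRingType) (n : nat) (i j : 'I_n)
    (b : 'M[K]_n) : \tr (delta_mx i j *m b) = b j i.
Proof.
rewrite /mxtrace (bigD1 i) //= big1 => [|k /negPf ne_ki]; rewrite mxE.
  rewrite (bigD1 j) //= big1 => [|l /negPf ne_lj]; rewrite mxE !eqxx.
    by rewrite mul1r !addr0.
  by rewrite ne_lj mul0r.
by rewrite big1 // => l _; rewrite mxE ne_ki mul0r.
Qed.

Lemma upper_trig_delta (R : realType) (n : nat) (i j : 'I_n) :
  (i <= j)%N -> upper_trig (delta_mx i j : 'M[R[i]]_n).
Proof.
move=> le_ij; apply/upper_trigP => k l lt_lk; rewrite mxE.
case: andP => [[/eqP eq_ki /eqP eq_lj] | //]; move: lt_lk.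
by rewrite eq_ki eq_lj ltnNge le_ij.
Qed.

Lemma upper_trig_cst_diag_delta (R : realType) (n : nat) (i j : 'I_n) :
  (i < j)%N -> upper_trig_cst_diag (delta_mx i j : 'M[R[i]]_n).
Proof.
move=> lt_ij; split; first exact/upper_trig_delta/ltnW.
exists 0 => k; rewrite mxE; case: eqP => [-> | //].
by rewrite -val_eqE /= ltn_eqF.
Qed.

(** Testing the trace condition on the strictly upper triangular matrix units
    kills every entry below the diagonal. *)
Lemma mult_compl_delta_upper_trig (R : realType) (n : nat)
    (E : set 'M[R[i]]_n) (b : 'M[R[i]]_n) :
  (0 < n)%N -> (forall i j : 'I_n, (i < j)%N -> E (delta_mx i j)) ->
  mult_compl E b -> upper_trig b.
Proof.
move=> n_gt0 E_delta bE; apply/upper_trigP => i j lt_ji.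
have := mult_compl_trace n_gt0 bE (E_delta _ _ lt_ji).
rewrite mxtrace_delta_mul mxtrace_delta -val_eqE /= ltn_eqF // mul0r.
by move/eqP; rewrite mulf_eq0 pnatr_eq0 -[n == 0%N]negbK -lt0n n_gt0 => /eqP.
Qed.

Theorem theorem6p13 (R : realType) (n : nat) (hn : (1 <= n)%N) :
  mult_complementary_pair (@upper_trig R n) (@upper_trig_cst_diag R n).
Proof.
split; apply/seteqP; split=> b.
- move=> b_compl; split.
    apply: mult_compl_delta_upper_trig b_compl => // i j /ltnW.
    exact: upper_trig_delta.
  exists (\tr b / n%:R) => i.
  have := mult_compl_trace hn b_compl (upper_trig_delta R (leqnn i)).
  rewrite mxtrace_delta_mul mxtrace_delta eqxx mul1r => <-.
  by rewrite mulrC mulrA mulVf ?mul1r // pnatr_eq0 -lt0n.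
- by move=> b_cst a a_trig; apply: char_poly_mul_cst_diag.
- by apply: mult_compl_delta_upper_trig => // i j; apply: upper_trig_cst_diag_delta.
- by move=> b_trig a a_cst; apply: char_poly_cst_diag_mul.
Qed.
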